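(* Every two-dimensional complex post-Lie algebra $(V,\cdot,\{\,,\})$ is isomorphic to exactly one of the following post-Lie algebras, each given on a basis $(e_1,e_2)$ by its product $\cdot$ (products of basis vectors not listed are zero) and its bracket $\{\,,\}$; the associated Lie bracket $[x,y]=x\cdot y-y\cdot x+\{x,y\}$ is also indicated. With $\{e_1,e_2\}=0$ and $[e_1,e_2]=0$: - $V_1$: all products zero; - $V_2$: $e_1\cdot e_1=e_1$; - $V_3$: $e_1\cdot e_1=e_1,\ e_2\cdot e_2=e_2$; - $V_4$: $e_1\cdot e_2=e_1,\ e_2\cdot e_1=e_1,\ e_2\cdot e_2=e_2$; - $V_5$: $e_2\cdot e_2=e_1$. With $\{e_1,e_2\}=-e_1$ and $[e_1,e_2]=0$: - $V_6$: $e_1\cdot e_1=e_1,\ e_2\cdot e_1=-e_1$; - $V_7$: $e_1\cdot e_2=e_1$; - $V_8$: $e_2\cdot e_1=-e_1$. With $\{e_1,e_2\}=0$ and $[e_1,e_2]=e_1$: - $V_9(\alpha)$, $\alpha\in\mathbb{C}$: $e_2\cdot e_1=-e_1,\ e_2\cdot e_2=\alpha e_2$; - $V_{10}(\beta)$, $\beta\in\mathbb{C}\setminus\{0\}$: $e_1\cdot e_2=\beta e_1,\ e_2\cdot e_1=(\beta-1)e_1,\ e_2\cdot e_2=\beta e_2$; - $V_{11}$: $e_2\cdot e_1=-e_1,\ e_2\cdot e_2=e_1-e_2$; - $V_{12}$: $e_1\cdot e_1=e_2,\ e_2\cdot e_1=-e_1,\ e_2\cdot e_2=-2e_2$; - $V_{13}$: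 $e_1\cdot e_2=e_1,\ e_2\cdot e_2=e_1+e_2$. With $\{e_1,e_2\}=e_1$: - $V_{14,\alpha_1}$, $\alpha_1\in\mathbb{C}\setminus\{0\}$: $e_2\cdot e_1=(1-\alpha_1)e_1$, with $[e_1,e_2]=\alpha_1e_1$; - $V_{15}$: $e_2\cdot e_2=e_1$, with $[e_1,e_2]=e_1$; - $V_{16,\alpha_1}$, $\alpha_1\in\mathbb{C}\setminus\{0\}$: $e_1\cdot e_2=-e_1,\ e_2\cdot e_1=-\alpha_1e_1$, with $[e_1,e_2]=\alpha_1e_1$; - $V_{17}$: $e_1\cdot e_2=-e_1,\ e_2\cdot e_1=e_1,\ e_2\cdot e_2=e_1$, with $[e_1,e_2]=-e_1$.
   Context: A post-Lie algebra $(V,\cdot,\{\,,\})$ over a field $k$ is a $k$-vector space $V$ with two $k$-bilinear operations $x\cdot y$ and $\{x,y\}$ satisfying, for all $x,y,z\in V$: (a) $\{x,y\}+\{y,x\}=0$; (b) $\{\{x,y\},z\}+\{\{y,z\},x\}+\{\{z,x\},y\}=0$; (c) $\{x,y\}\cdot z=(y\cdot x)\cdot z-y\cdot(x\cdot z)-(x\cdot y)\cdot z+x\cdot(y\cdot z)$; (d) $x\cdot\{y,z\}=\{x\cdot y,z\}+\{y,x\cdot z\}$. Two post-Lie algebras $V,W$ are isomorphic if there is a bijective linear map $\phi\colon V\to W$ with $\phi(x\cdot y)=\phi(x)\cdot\phi(y)$ and $\phi(\{x,y\})=\{\phi(x),\phi(y)\}$ for all $x,y\in V$. Here $k=\mathbb{C}$.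 *)

(* Defs.v *)
From HB Require Import structures.
From mathcomp Require Import all_boot all_order all_algebra.
From mathcomp Require Import reals.
From mathcomp.real_closed Require Export complex.

Set Implicit Arguments.
Unset Strict Implicit.
Unset Printing Implicit Defensive.

Import GRing.Theory.
Local Open Scope ring_scope.

Section PostLie.
Variables (k : fieldType).

Record post_lie (V : lmodType k) (mul br : V -> V -> V) : Prop := PostLie {
  pl_mul_bilin : bilinear_for *:%R *:%R mul;
  pl_br_bilin : bilinear_for *:%R *:%R br;
  pl_anti : forall x y, br x y + br y x = 0;
  pl_jacobi : forall x y z,
    br (br x y) z + br (br y z) x + br (br z x) y = 0;
  pl_assoc : forall x y z,
    mul (br x y) z =
      mul (mul y x) z - mul y (mul x z) - mul (mul x y) z + mul x (mul y z);
  pl_der : forall x y z,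
    mul x (br y z) = br (mul x y) z + br y (mul x z)
}.

Definition post_lie_iso (V W : lmodType k)
    (mulV brV : V -> V -> V) (mulW brW : W -> W -> W) : Prop :=
  exists phi : {linear V -> W},
    [/\ bijective phi,
        forall x y, phi (mulV x y) = mulW (phi x) (phi y)
      & forall x y, phi (brV x y) = brW (phi x) (phi y)].

Definition assoc_lie (V : lmodType k) (mul br : V -> V -> V) (x y : V) : V :=
  mul x y - mul y x + br x y.

Definition e1 : 'rV[k]_2 := delta_mx 0 0.
Definition e2 : 'rV[k]_2 := delta_mx 0 1.

(* Distinct parameter values give distinct indices. *)
Inductive pl_index : Type :=
  | V1 | V2 | V3 | V4 | V5
  | V6 | V7 | V8
  | V9 (alpha : k)
  | V10 (beta : k) of beta != 0
  | V11 | V12 | V13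
  | V14 (alpha1 : k) of alpha1 != 0
  | V15
  | V16 (alpha1 : k) of alpha1 != 0
  | V17.

Record pl_table : Type := Table {
  t_11 : 'rV[k]_2;  (* e1 . e1 *)
  t_12 : 'rV[k]_2;  (* e1 . e2 *)
  t_21 : 'rV[k]_2;  (* e2 . e1 *)
  t_22 : 'rV[k]_2;  (* e2 . e2 *)
  t_br : 'rV[k]_2;  (* {e1, e2} *)
  t_lie : 'rV[k]_2  (* the value claimed for [e1, e2] *)
}.

Definition table (m : pl_index) : pl_table :=
  match m with
  (*                 e1.e1 e1.e2         e2.e1               e2.e2
                     {e1,e2}  [e1,e2]  *)
  | V1 =>      Table 0     0             0                   0            0 0
  | V2 =>      Table e1    0             0                   0            0 0
  | V3 =>      Table e1    0             0                   e2           0 0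
  | V4 =>      Table 0     e1            e1                  e2           0 0
  | V5 =>      Table 0     0             0                   e1           0 0
  | V6 =>      Table e1    0             (- e1)              0       (- e1) 0
  | V7 =>      Table 0     e1            0                   0       (- e1) 0
  | V8 =>      Table 0     0             (- e1)              0       (- e1) 0
  | V9 a =>    Table 0     0             (- e1)              (a *: e2)    0 e1
  | V10 b _ => Table 0     (b *: e1)     ((b - 1) *: e1)     (b *: e2)    0 e1
  | V11 =>     Table 0     0             (- e1)              (e1 - e2)    0 e1
  | V12 =>     Table e2    0             (- e1)              (- 2 *: e2)  0 e1
  | V13 =>     Table 0     e1            0                   (e1 + e2)    0 e1
  | V14 a _ => Table 0     0             ((1 - a) *: e1)     0     e1 (a *: e1)
  | V15 =>     Table 0     0             0                   e1    e1 e1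
  | V16 a _ => Table 0     (- e1)        (- a *: e1)         0     e1 (a *: e1)
  | V17 =>     Table 0     (- e1)        e1                  e1    e1 (- e1)
  end.

(* The bilinear extension of the four products of basis vectors, and the
   alternating bilinear extension of the value of {e1, e2}. *)
Definition pl_mul (m : pl_index) (x y : 'rV[k]_2) : 'rV[k]_2 :=
  (x 0 0 * y 0 0) *: t_11 (table m) + (x 0 0 * y 0 1) *: t_12 (table m)
  + (x 0 1 * y 0 0) *: t_21 (table m) + (x 0 1 * y 0 1) *: t_22 (table m).

Definition pl_br (m : pl_index) (x y : 'rV[k]_2) : 'rV[k]_2 :=
  (x 0 0 * y 0 1 - x 0 1 * y 0 0) *: t_br (table m).

End PostLie.

(* Main.v *)
Require Import Defs.
From HB Require Import structures.
From mathcomp Require Import all_boot all_order all_algebra.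
From mathcomp Require Import reals ring.
From mathcomp.real_closed Require Import complex.

Set Implicit Arguments.
Unset Strict Implicit.
Unset Printing Implicit Defensive.

Import GRing.Theory.
Local Open Scope ring_scope.

(** An isomorphism from [V] onto a listed algebra is the same thing as a basis
    of [V], called a frame below, in which the two operations are given by the
    corresponding table ([iso_of_frame], [frame_of_iso]).  So one must find a
    frame of [V] realizing a table, and show that the table is determined by
    [V].

    Axiom (c) says that [L_[x,y] = [L_x, L_y]], where [L_x] is left
    multiplication by [x] and [[x,y] = x.y - y.x + {x,y}], and axiom (d) says
    that every [L_x] is a derivation of [{,}].  Both [{,}] and [[,]] are
    alternating, and a nonzero alternating bilinear map [B] on a plane has a
    frame with [B g1 g2 = g1], unique up to [g1 -> s g1], [g2 -> g2 + t g1] with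
    [s <> 0] ([alternating_frame], [alternating_frame_unique]).  This leads to
    three cases.

    - [{,} <> 0].  In a frame with [{g1,g2} = g1] the derivations send the plane
      into the line of [g1], so the product is given by four scalars, with
      [a1 (b1 - a2 + 1) = 0] and [b2 a1 = b1 (b1 + 1)].  The parameters [s] and
      [t] bring them to one of V6, V7, V8, V14, V15, V16, V17
      ([affine_normal_form]).

    - [{,} = 0] and [[,] <> 0].  In a frame with [[g1,g2] = g1] the matrices
      satisfy [L1 = [L1,L2]], so [L1] and [L1^2 = L1 [L1,L2]] have trace zero and
      [L1] is nilpotent.  If [g1] is not an eigenvector of [L1] one gets V12,
      otherwise one of V9, V10, V11, V13 ([nonabelian_normal_form]).

    - Both vanish.  The product is commutative and associative.  Either it is
      zero, or some [x] forms a frame with its square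
      ([square_frame_or_zero]); then [V] is the ideal [(T)] of
      [k[T]/(T(T-u)(T-v))], and V2, V3, V4, V5 correspond to the coincidences
      among [0], [u] and [v] ([commutative_normal_form]).

    For uniqueness, each structure on the plane gets an invariant: in the first
    two cases the scalars that [s] and [t] do not move, in the third the
    vanishing of the product and the existence of nonzero elements that square to
    zero, are idempotent, or annihilate everything.  The invariant depends only on the structure
    ([invariant_unique]) and separates the tables ([invariant_inj]). *)

(** * Frames of a plane and bilinear maps *)

Definition lc (k : fieldType) (V : lmodType k) (f1 f2 : V) (a b : k) : V :=
  a *: f1 + b *: f2.

Lemma linear_lc (k : fieldType) (V W : lmodType k) (F : V -> W) f1 f2 (a b : k) :
  linear_for *:%R F -> F (lc f1 f2 a b) = a *: F f1 + b *: F f2.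
Proof.
move=> linF.
have F0 : F 0 = 0.
  by move: (linF (-1) 0 0); rewrite scaler0 addr0 scaleN1r addNr.
have FZ c v : F (c *: v) = c *: F v by rewrite -[c *: v]addr0 linF F0 addr0.
by rewrite /lc linF FZ.
Qed.

Section Frames.
Variables (k : fieldType) (V : lmodType k).
Implicit Types (f g v w : V) (B : V -> V -> V).

Definition frame f1 f2 : Prop :=
  (forall v, exists a b, v = lc f1 f2 a b) /\
  (forall a b, lc f1 f2 a b = 0 -> a = 0 /\ b = 0).

Lemma lcD f1 f2 a b c d : lc f1 f2 a b + lc f1 f2 c d = lc f1 f2 (a + c) (b + d).
Proof. by rewrite /lc addrACA -!scalerDl. Qed.

Lemma lcZ f1 f2 a b c : c *: lc f1 f2 a b = lc f1 f2 (c * a) (c * b).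
Proof. by rewrite /lc scalerDr !scalerA. Qed.

Lemma lcN f1 f2 a b : - lc f1 f2 a b = lc f1 f2 (- a) (- b).
Proof. by rewrite -scaleN1r lcZ !mulN1r. Qed.

Lemma lc10 f1 f2 : lc f1 f2 1 0 = f1.
Proof. by rewrite /lc scale1r scale0r addr0. Qed.

Lemma lc01 f1 f2 : lc f1 f2 0 1 = f2.
Proof. by rewrite /lc scale1r scale0r add0r. Qed.

Lemma lc00 f1 f2 : lc f1 f2 0 0 = 0.
Proof. by rewrite /lc !scale0r addr0. Qed.

Lemma lc_lc f1 f2 p q r s a b :
  lc (lc f1 f2 p q) (lc f1 f2 r s) a b = lc f1 f2 (a * p + b * r) (a * q + b * s).
Proof. by rewrite {1}/lc !lcZ lcD. Qed.

Lemma lc_eq f1 f2 a b c d : a = c -> b = d -> lc f1 f2 a b = lc f1 f2 c d.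
Proof. by move=> -> ->. Qed.

Lemma lc_eq0 f1 f2 a b : a = 0 -> b = 0 -> lc f1 f2 a b = 0.
Proof. by move=> -> ->; rewrite lc00. Qed.

Lemma frame_inj f1 f2 a b c d :
  frame f1 f2 -> lc f1 f2 a b = lc f1 f2 c d -> a = c /\ b = d.
Proof.
move=> [_ free_f] /eqP; rewrite -subr_eq0 lcN lcD => /eqP /free_f [/eqP + /eqP].
by rewrite !subr_eq0 => /eqP -> /eqP ->.
Qed.

Lemma frame_change f1 f2 p q r s :
  frame f1 f2 -> p * s - q * r != 0 -> frame (lc f1 f2 p q) (lc f1 f2 r s).
Proof.
move=> frf D0; split=> [v|a b].
  have [a [b ->]] := frf.1 v.
  exists ((a * s - b * r) / (p * s - q * r)), ((b * p - a * q) / (p * s - q * r)).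
  by rewrite lc_lc; apply: lc_eq; field.
rewrite lc_lc => /frf.2 [e e'].
have ea : a * (p * s - q * r) = 0.
  transitivity ((a * p + b * r) * s - (a * q + b * s) * r); first by ring.
  by rewrite e e' !mul0r subr0.
have eb : b * (p * s - q * r) = 0.
  transitivity ((a * q + b * s) * p - (a * p + b * r) * q); first by ring.
  by rewrite e e' !mul0r subr0.
move/eqP: ea; move/eqP: eb; rewrite !mulf_eq0 !(negPf D0) !orbF.
by move=> /eqP -> /eqP ->.
Qed.

Definition bilin B := bilinear_for *:%R *:%R B.

Lemma bilinPl B a x y z : bilin B -> B (a *: x + y) z = a *: B x z + B y z.
Proof. by case=> linl _; apply: linl. Qed.

Lemma bilinPr B a x y z : bilin B -> B z (a *: x + y) = a *: B z x + B z y.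
Proof. by case=> _ linr; apply: linr. Qed.

Lemma bilin_lcl B f1 f2 a b v : bilin B ->
  B (lc f1 f2 a b) v = a *: B f1 v + b *: B f2 v.
Proof. by case=> linl _; apply: (linear_lc _ _ _ _ (linl v)). Qed.

Lemma bilin_lc B f1 f2 a b c d : bilin B ->
  B (lc f1 f2 a b) (lc f1 f2 c d) =
    (a * c) *: B f1 f1 + (a * d) *: B f1 f2 + (b * c) *: B f2 f1
    + (b * d) *: B f2 f2.
Proof.
move=> [linl linr].
rewrite (linear_lc _ _ _ _ (linl _)) !(linear_lc _ _ _ _ (linr _)).
by rewrite !scalerDr !scalerA !addrA.
Qed.

(** The structure constants of [B]: the pair [(aij, bij)] gives the coordinates
    of [B fi fj]. *)
Definition table_in B f1 f2 (a11 b11 a12 b12 a21 b21 a22 b22 : k) : Prop :=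
  [/\ B f1 f1 = lc f1 f2 a11 b11, B f1 f2 = lc f1 f2 a12 b12,
      B f2 f1 = lc f1 f2 a21 b21 & B f2 f2 = lc f1 f2 a22 b22].

Lemma table_exists B f1 f2 : frame f1 f2 ->
  exists a11 b11 a12 b12 a21 b21 a22 b22,
    table_in B f1 f2 a11 b11 a12 b12 a21 b21 a22 b22.
Proof.
move=> [span_f _].
have [a11 [b11 e11]] := span_f (B f1 f1).
have [a12 [b12 e12]] := span_f (B f1 f2).
have [a21 [b21 e21]] := span_f (B f2 f1).
have [a22 [b22 e22]] := span_f (B f2 f2).
by exists a11, b11, a12, b12, a21, b21, a22, b22.
Qed.

Lemma bilin_table B f1 f2 a11 b11 a12 b12 a21 b21 a22 b22 : bilin B ->
  table_in B f1 f2 a11 b11 a12 b12 a21 b21 a22 b22 ->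
  forall x y z w : k, B (lc f1 f2 x y) (lc f1 f2 z w) =
    lc f1 f2 (x * z * a11 + x * w * a12 + y * z * a21 + y * w * a22)
             (x * z * b11 + x * w * b12 + y * z * b21 + y * w * b22).
Proof.
move=> bilB [e11 e12 e21 e22] x y z w.
by rewrite bilin_lc // e11 e12 e21 e22 !lcZ !lcD.
Qed.

Definition alternating B := forall x, B x x = 0.

Lemma alternating_anti B x y : bilin B -> alternating B -> B y x = - B x y.
Proof.
move=> bilB altB; have := bilin_lc x y 1 1 1 1 bilB.
rewrite !altB !scaler0 add0r addr0 mulr1 !scale1r => /esym/eqP.
by rewrite addrC addr_eq0 => /eqP.
Qed.

Lemma alternating_lc B f1 f2 a b c d : bilin B -> alternating B ->
  B (lc f1 f2 a b) (lc f1 f2 c d) = (a * d - b * c) *: B f1 f2.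
Proof.
move=> bilB altB; rewrite bilin_lc // !altB !scaler0 addr0 add0r.
by rewrite [B f2 f1]alternating_anti // scalerN -scalerBl.
Qed.

(** If [B f1 f2 = w <> 0], then [B] takes its values on the line of [w]; take
    [g1 = w] and choose [g2] so that the change of frame
    has determinant one. *)
Lemma alternating_frame B f1 f2 : bilin B -> alternating B -> frame f1 f2 ->
  B f1 f2 != 0 -> exists g1 g2, frame g1 g2 /\ B g1 g2 = g1.
Proof.
move=> bilB altB frf; have [a [b Bf]] := frf.1 (B f1 f2).
have [a0|a0 _] := eqVneq a 0.
  rewrite a0 in Bf; have [b0|b0 _] := eqVneq b 0; first by rewrite Bf b0 lc00 eqxx.
  exists (lc f1 f2 0 b), (lc f1 f2 (- b^-1) 0); split.
    by apply: frame_change => //; rewrite mul0r sub0r mulrN opprK divff ?oner_eq0.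
  by rewrite alternating_lc // Bf lcZ; apply: lc_eq; field.
exists (lc f1 f2 a b), (lc f1 f2 0 a^-1); split.
  by apply: frame_change => //; rewrite mulr0 subr0 divff // oner_eq0.
by rewrite alternating_lc // Bf lcZ; apply: lc_eq; field.
Qed.

(** Both [f1] and [g1] span the line of values of [B], and the determinant of
    the change of frame must equal the factor between them. *)
Lemma alternating_frame_unique B f1 f2 g1 g2 : bilin B -> alternating B ->
  frame f1 f2 -> B f1 f2 = f1 -> frame g1 g2 -> B g1 g2 = g1 ->
  exists s t, [/\ s != 0, g1 = lc f1 f2 s 0 & g2 = lc f1 f2 t 1].
Proof.
move=> bilB altB frf Bf frg.
have [p [q e1]] := frf.1 g1; have [r [u e2]] := frf.1 g2.
rewrite e1 e2 alternating_lc // Bf => e.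
have : lc f1 f2 (p * u - q * r) 0 = lc f1 f2 p q.
  by rewrite -e /lc scale0r addr0.
move=> /(frame_inj frf) [ep eq0]; rewrite -eq0 in e1 ep *.
have p0 : p != 0.
  apply/negP => /eqP p0; have /frg.2 [/eqP] : lc g1 g2 1 0 = 0.
    by rewrite lc10 e1 p0 lc00.
  by rewrite oner_eq0.
exists p, r; split=> //; congr lc.
by apply: (mulfI p0); rewrite mulr1 -[RHS]ep mul0r subr0.
Qed.

End Frames.

Lemma alternating_table (k : fieldType) (V : lmodType k) (B : V -> V -> V)
    (f1 f2 : V) (p q : k) :
  bilin B -> alternating B -> B f1 f2 = lc f1 f2 p q ->
  table_in B f1 f2 0 0 p q (- p) (- q) 0 0.
Proof.
move=> bilB altB e; split; rewrite ?altB ?lc00 //.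
by rewrite alternating_anti // e lcN.
Qed.

(** * Isomorphisms onto the tables are frames *)

Lemma pl_mul_e (k : fieldType) (m : pl_index k) :
  [/\ pl_mul m (e1 k) (e1 k) = t_11 (table m),
      pl_mul m (e1 k) (e2 k) = t_12 (table m),
      pl_mul m (e2 k) (e1 k) = t_21 (table m)
    & pl_mul m (e2 k) (e2 k) = t_22 (table m)].
Proof.
by rewrite /pl_mul !mxE /= !(mulr0, mul0r, mulr1, scale0r, scale1r, addr0, add0r).
Qed.

Lemma pl_br_e (k : fieldType) (m : pl_index k) :
  pl_br m (e1 k) (e2 k) = t_br (table m).
Proof. by rewrite /pl_br !mxE /= !(mulr0, mulr1, subr0, scale1r). Qed.

Section Indices.
Variables (k : fieldType) (V : lmodType k).
Implicit Types (f v : V) (w : 'rV[k]_2) (mul br : V -> V -> V).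

Definition lin f1 f2 (w : 'rV[k]_2) : V := lc f1 f2 (w 0 0) (w 0 1).

Lemma lin_is_linear f1 f2 : linear (lin f1 f2).
Proof. by move=> a u v; rewrite /lin !mxE lcZ lcD. Qed.

Lemma linZ f1 f2 a w : lin f1 f2 (a *: w) = a *: lin f1 f2 w.
Proof. by rewrite /lin !mxE lcZ. Qed.
Lemma linD f1 f2 w w' : lin f1 f2 (w + w') = lin f1 f2 w + lin f1 f2 w'.
Proof. by rewrite /lin !mxE lcD. Qed.
Lemma linN f1 f2 w : lin f1 f2 (- w) = - lin f1 f2 w.
Proof. by rewrite /lin !mxE lcN. Qed.
Lemma lin0 f1 f2 : lin f1 f2 0 = 0.
Proof. by rewrite /lin !mxE lc00. Qed.
Lemma lin_e1 f1 f2 : lin f1 f2 (e1 k) = f1.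
Proof. by rewrite /lin !mxE /= lc10. Qed.
Lemma lin_e2 f1 f2 : lin f1 f2 (e2 k) = f2.
Proof. by rewrite /lin !mxE /= lc01. Qed.
Definition linE := (linZ, linD, linN, lin0, lin_e1, lin_e2).

Lemma lc_e (a b : k) : lc (e1 k) (e2 k) a b = \row_(j < 2) (if j == 0 then a else b).
Proof.
apply/rowP => j; rewrite !mxE eqxx /=.
by case: (altP (j =P 0)) => [->|]; case: j => [[|[]]] //= *; rewrite ?mulr1 ?mulr0 ?addr0 ?add0r.
Qed.

Lemma row_lc (w : 'rV[k]_2) : w = lc (e1 k) (e2 k) (w 0 0) (w 0 1).
Proof.
rewrite lc_e; apply/rowP => j; rewrite mxE.
by case: (altP (j =P 0)) => [->//|]; case: j => [[|[]]] //= *; congr (w _ _); apply/val_inj.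
Qed.

(** The product part is stated with [table_in]; it is convertible to equations
    [mul fi fj = lin f1 f2 (t_ij (table m))], which [realizesI] exploits. *)
Definition realizes mul br f1 f2 (m : pl_index k) : Prop :=
  [/\ table_in mul f1 f2
        (t_11 (table m) 0 0) (t_11 (table m) 0 1) (t_12 (table m) 0 0) (t_12 (table m) 0 1)
        (t_21 (table m) 0 0) (t_21 (table m) 0 1) (t_22 (table m) 0 0) (t_22 (table m) 0 1)
    & br f1 f2 = lin f1 f2 (t_br (table m))].

Lemma realizesI mul br f1 f2 m :
  mul f1 f1 = lin f1 f2 (t_11 (table m)) ->
  mul f1 f2 = lin f1 f2 (t_12 (table m)) ->
  mul f2 f1 = lin f1 f2 (t_21 (table m)) ->
  mul f2 f2 = lin f1 f2 (t_22 (table m)) ->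
  br f1 f2 = lin f1 f2 (t_br (table m)) ->
  realizes mul br f1 f2 m.
Proof. by []. Qed.

(** The isomorphism is the coordinate map of the frame, the inverse of
    [lin f1 f2]. *)
Lemma iso_of_frame mul br f1 f2 m :
  bilin mul -> bilin br -> alternating br ->
  frame f1 f2 -> realizes mul br f1 f2 m ->
  post_lie_iso mul br (pl_mul m) (pl_br m).
Proof.
move=> bilm bilb altb frf [[e11 e12 e21 e22] eb].
pose psi : {linear 'rV[k]_2 -> V} :=
  HB.pack (lin f1 f2) (GRing.isLinear.Build _ _ _ _ _ (lin_is_linear f1 f2)).
have psi_surj v : exists w, lin f1 f2 w == v.
  have [a [b ->]] := frf.1 v; exists (lc (e1 k) (e2 k) a b).
  by apply/eqP; rewrite (linear_lc _ _ _ _ (lin_is_linear f1 f2)) lin_e1 lin_e2.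
pose h v := xchoose (psi_surj v).
have hK : cancel h psi by move=> v; apply/eqP/(xchooseP (psi_surj v)).
have psi_inj : injective psi.
  move=> u w /(frame_inj frf) [e e'].
  by rewrite (row_lc u) (row_lc w) e e'.
have psiK : cancel psi h by move=> w; apply: psi_inj; rewrite hK.
pose phi : {linear V -> 'rV[k]_2} :=
  HB.pack h (GRing.isLinear.Build _ _ _ _ _ (can2_linear psiK hK)).
have psiE w : psi w = lin f1 f2 w by [].
exists phi; split; first by exists psi.
- move=> x y; apply: psi_inj; rewrite [LHS]hK -[x in LHS]hK -[y in LHS]hK !psiE.
  by rewrite /pl_mul !linD !linZ [in LHS]/lin bilin_lc // e11 e12 e21 e22.
- move=> x y; apply: psi_inj; rewrite [LHS]hK -[x in LHS]hK -[y in LHS]hK !psiE.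
  by rewrite /pl_br linZ [in LHS]/lin alternating_lc // eb.
Qed.

(** The frame is the preimage of [(e1, e2)]. *)
Lemma frame_of_iso mul br m :
  post_lie_iso mul br (pl_mul m) (pl_br m) ->
  exists f1 f2, frame f1 f2 /\ realizes mul br f1 f2 m.
Proof.
move=> [phi [[h hK Kh] phim phib]].
have linh : linear h by exact: can2_linear hK Kh.
have h_lc w : h w = lin (h (e1 k)) (h (e2 k)) w.
  by rewrite [in LHS](row_lc w) linear_lc.
exists (h (e1 k)), (h (e2 k)); split.
  split=> [v|a b].
    by exists (phi v 0 0), (phi v 0 1); rewrite -[LHS]hK h_lc.
  rewrite -[lc _ _ _ _](linear_lc _ _ a b linh) => /(congr1 phi); rewrite Kh linear0 lc_e.
  by move=> /rowP e; move: (e 0) (e 1); rewrite !mxE.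
have mul_h u w : mul (h u) (h w) = h (pl_mul m u w).
  by rewrite -[LHS]hK phim !Kh.
have br_h u w : br (h u) (h w) = h (pl_br m u w).
  by rewrite -[LHS]hK phib !Kh.
have [e11 e12 e21 e22] := pl_mul_e m.
apply: realizesI; rewrite -h_lc ?mul_h ?br_h ?e11 ?e12 ?e21 ?e22 ?pl_br_e //.
Qed.

End Indices.

(** * Post-Lie structures in a frame *)

(** Axiom (c) for [x = f1], [y = f2] and [z = f1, f2], in coordinates, where
    [(p, q)] are the coordinates of the bracket of [f1] and [f2].  Both sides of
    (c) are alternating in [(x, y)] and linear in [z], so these four equations
    are equivalent to it. *)
Definition assoc_equations (k : fieldType)
    (a11 b11 a12 b12 a21 b21 a22 b22 p q : k) : Prop :=
  [/\ p * a11 + q * a21 = (a21 * a11 + b21 * a21) - (a11 * a21 + b11 * a22)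
        - (a12 * a11 + b12 * a21) + (a21 * a11 + b21 * a12),
      p * b11 + q * b21 = (a21 * b11 + b21 * b21) - (a11 * b21 + b11 * b22)
        - (a12 * b11 + b12 * b21) + (a21 * b11 + b21 * b12),
      p * a12 + q * a22 = (a21 * a12 + b21 * a22) - (a12 * a21 + b12 * a22)
        - (a12 * a12 + b12 * a22) + (a22 * a11 + b22 * a12)
    & p * b12 + q * b22 = (a21 * b12 + b21 * b22) - (a12 * b21 + b12 * b22)
        - (a12 * b12 + b12 * b22) + (a22 * b11 + b22 * b12)].

Section PostLieFrames.
Variables (k : fieldType) (V : lmodType k) (mul br : V -> V -> V).
Hypothesis two_neq0 : 2 != 0 :> k.
Hypothesis plV : post_lie mul br.

Let bilm : bilin mul := pl_mul_bilin plV.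
Let bilb : bilin br := pl_br_bilin plV.

Lemma br_alternating : alternating br.
Proof.
move=> x; have := pl_anti plV x x; rewrite -mulr2n -scaler_nat => /eqP.
by rewrite scaler_eq0 (negPf two_neq0) => /eqP.
Qed.

Lemma assoc_lie_bilin : bilin (assoc_lie mul br).
Proof.
split=> z a x y; rewrite /assoc_lie /=.
  rewrite !(bilinPl _ _ _ _ bilm, bilinPr _ _ _ _ bilm, bilinPl _ _ _ _ bilb).
  by rewrite !scalerDr scalerN opprD [_ + _ + (- _ - _)]addrACA [LHS]addrACA.
rewrite !(bilinPl _ _ _ _ bilm, bilinPr _ _ _ _ bilm, bilinPr _ _ _ _ bilb).
by rewrite !scalerDr scalerN opprD [_ + _ + (- _ - _)]addrACA [LHS]addrACA.
Qed.

Lemma assoc_lie_alternating : alternating (assoc_lie mul br).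
Proof. by move=> x; rewrite /assoc_lie subrr add0r br_alternating. Qed.

Lemma post_lie_table f1 f2 a11 b11 a12 b12 a21 b21 a22 b22 p q :
  frame f1 f2 -> table_in mul f1 f2 a11 b11 a12 b12 a21 b21 a22 b22 ->
  br f1 f2 = lc f1 f2 p q ->
  assoc_equations a11 b11 a12 b12 a21 b21 a22 b22 p q.
Proof.
move=> frf tf ebr; have [e11 e12 e21 e22] := tf.
have mulE := bilin_table bilm tf.
have mul1E z w : mul f1 (lc f1 f2 z w) =
    lc f1 f2 (z * a11 + w * a12) (z * b11 + w * b12).
  by rewrite -{1}(lc10 f1 f2) mulE; apply: lc_eq; ring.
have mul2E z w : mul f2 (lc f1 f2 z w) =
    lc f1 f2 (z * a21 + w * a22) (z * b21 + w * b22).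
  by rewrite -{1}(lc01 f1 f2) mulE; apply: lc_eq; ring.
have mulE1 z w : mul (lc f1 f2 z w) f1 =
    lc f1 f2 (z * a11 + w * a21) (z * b11 + w * b21).
  by rewrite -{2}(lc10 f1 f2) mulE; apply: lc_eq; ring.
have mulE2 z w : mul (lc f1 f2 z w) f2 =
    lc f1 f2 (z * a12 + w * a22) (z * b12 + w * b22).
  by rewrite -{2}(lc01 f1 f2) mulE; apply: lc_eq; ring.
have := pl_assoc plV f1 f2 f1.
rewrite ebr e11 e12 e21 !mulE1 mul1E mul2E !lcN !lcD => /(frame_inj frf) [E1 E2].
have := pl_assoc plV f1 f2 f2.
rewrite ebr e22 e12 e21 !mulE2 mul1E mul2E !lcN !lcD => /(frame_inj frf) [E3 E4].
by split.
Qed.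

End PostLieFrames.

(** The converse of [post_lie_table].  The last four equations are axiom (d): both
    of its sides are linear in [x] and alternating in [(y, z)], and
    [{L f1, f2} + {f1, L f2}] is the trace of [L] times the bracket of [f1] and
    [f2]. *)
Lemma post_lie_of_table (k : fieldType) (V : lmodType k) (mul br : V -> V -> V)
    f1 f2 a11 b11 a12 b12 a21 b21 a22 b22 p q :
  bilin mul -> bilin br -> alternating br ->
  frame f1 f2 -> table_in mul f1 f2 a11 b11 a12 b12 a21 b21 a22 b22 ->
  br f1 f2 = lc f1 f2 p q ->
  assoc_equations a11 b11 a12 b12 a21 b21 a22 b22 p q ->
  [/\ q * a12 = p * b12, p * b11 = q * a11, q * a22 = p * b22 & p * b21 = q * a21] ->
  post_lie mul br.
Proof.
move=> bilm bilb altb frf tf brf [E1 E2 E3 E4] [D1 D2 D3 D4].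
have mulE := bilin_table bilm tf.
have brE : forall x y z w : k, _ := bilin_table bilb (alternating_table bilb altb brf).
have linear_comb0 (u w : k) c d (x y z t : k) :
  x = y -> z = t -> u - w = c * (x - y) + d * (z - t) -> u = w.
  by move=> -> -> /eqP; rewrite !subrr !mulr0 addr0 subr_eq0 => /eqP.
split=> //.
- by move=> x y; rewrite (alternating_anti x y) // subrr.
- move=> x y z; have [x1 [x2 ->]] := frf.1 x; have [y1 [y2 ->]] := frf.1 y.
  have [z1 [z2 ->]] := frf.1 z; rewrite !brE !lcD.
  by apply: lc_eq0; ring.
- move=> x y z; have [x1 [x2 ->]] := frf.1 x; have [y1 [y2 ->]] := frf.1 y.
  have [z1 [z2 ->]] := frf.1 z; rewrite !(brE, mulE) !(lcN, lcD).
  apply: lc_eq.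
    apply: (linear_comb0 _ _ ((x1 * y2 - x2 * y1) * z1) ((x1 * y2 - x2 * y1) * z2)
      _ _ _ _ E1 E3).
    by ring.
  apply: (linear_comb0 _ _ ((x1 * y2 - x2 * y1) * z1) ((x1 * y2 - x2 * y1) * z2)
    _ _ _ _ E2 E4).
  by ring.
move=> x y z; have [x1 [x2 ->]] := frf.1 x; have [y1 [y2 ->]] := frf.1 y.
have [z1 [z2 ->]] := frf.1 z; rewrite !(brE, mulE) !(lcN, lcD).
apply: lc_eq.
  apply: (linear_comb0 _ _ ((y1 * z2 - y2 * z1) * x1) ((y1 * z2 - y2 * z1) * x2)
    _ _ _ _ D1 D3).
  by ring.
apply: (linear_comb0 _ _ ((y1 * z2 - y2 * z1) * x1) ((y1 * z2 - y2 * z1) * x2)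
  _ _ _ _ D2 D4).
by ring.
Qed.

(** * Nonzero bracket *)

(* Compares two linear combinations of the same frame; the scalar identities hold
   in the field. *)
Ltac lc_field :=
  rewrite ?(lcZ, lcN, lcD); (apply: lc_eq || apply: lc_eq0); field;
  rewrite ?oner_neq0 ?andbT.

Section Affine.
Variables (k : fieldType) (V : lmodType k) (mul br : V -> V -> V).
Hypothesis two_neq0 : 2 != 0 :> k.
Hypothesis plV : post_lie mul br.

Let bilm : bilin mul := pl_mul_bilin plV.
Let bilb : bilin br := pl_br_bilin plV.
Let altb : alternating br := br_alternating two_neq0 plV.

(** With this bracket the plane is the affine Lie algebra, whose derivations send
    [f1] and [f2] to multiples of [f1]: the second coordinates in the table vanish. *)
Definition affine_frame f1 f2 (a1 b1 a2 b2 : k) : Prop :=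
  [/\ frame f1 f2, br f1 f2 = f1 & table_in mul f1 f2 a1 0 b1 0 a2 0 b2 0].

(** For a derivation [D] with [D f1 = (a, b)] and [D f2 = (c, d)], applying [D] to
    the bracket of [f1] and [f2] gives [(a, b) = (a + d, 0)].  The two equations are
    what remains of axiom (c). *)
Lemma affine_frame_exists f1 f2 :
  frame f1 f2 -> br f1 f2 = f1 ->
  exists a1 b1 a2 b2, [/\ affine_frame f1 f2 a1 b1 a2 b2,
    a1 * (b1 - a2 + 1) = 0 & b2 * a1 = b1 * (b1 + 1)].
Proof.
move=> frf brf.
have [a1 [c11 [b1 [c12 [a2 [c21 [b2 [c22 tf]]]]]]]] := table_exists mul frf.
have [e11 e12 e21 e22] := tf.
have in_line x a b c d : mul x f1 = lc f1 f2 a b -> mul x f2 = lc f1 f2 c d ->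
    b = 0 /\ d = 0.
  move=> e1 e2; have := pl_der plV x f1 f2; rewrite brf e1 e2.
  rewrite -[X in br _ X + _](lc01 f1 f2) -[X in _ + br X _](lc10 f1 f2).
  rewrite !alternating_lc // brf -scalerDl -[X in _ *: X](lc10 f1 f2) lcZ.
  move=> /(frame_inj frf) [ea ->]; rewrite mulr0; split=> //.
  by apply: (addrI a); rewrite addr0 [RHS]ea; ring.
have [b11 b12] := in_line _ _ _ _ _ e11 e12.
have [b21 b22] := in_line _ _ _ _ _ e21 e22.
rewrite b11 b12 b21 b22 in tf.
have brf' : br f1 f2 = lc f1 f2 1 0 by rewrite lc10.
have [E1 _ E3 _] := post_lie_table plV frf tf brf'.
exists a1, b1, a2, b2; split=> //.
  transitivity (1 * a1 + 0 * a2 - (1 * a1 + 0 * a2)); last by rewrite subrr.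
  by rewrite {2}E1; ring.
transitivity (b2 * a1 + (1 * b1 + 0 * b2) - (1 * b1 + 0 * b2)); first by ring.
by rewrite {2}E3; ring.
Qed.

(** Replacing [(f1, f2)] by [(s f1, f2 + t f1)] changes [(a1, b1, a2, b2)] into
    [(s a1, b1 + t a1, a2 + t a1, (b2 + t (a2 + b1) + t^2 a1) / s)].  If [a1 <> 0] one
    can kill [b1]; otherwise [b1] is [0] or [-1], and [b2] can be killed unless
    [a2 + b1 = 0].  For V6, V7 and V8 the sign of the second vector is reversed. *)
Lemma affine_normal_form f1 f2 a1 b1 a2 b2 :
  affine_frame f1 f2 a1 b1 a2 b2 ->
  a1 * (b1 - a2 + 1) = 0 -> b2 * a1 = b1 * (b1 + 1) ->
  exists m g1 g2, frame g1 g2 /\ realizes mul br g1 g2 m.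
Proof.
move=> [frf brf tf] E1 E2.
have mulE := bilin_table bilm tf.
have brE : forall x y z w : k, _ :=
  bilin_table bilb (alternating_table bilb altb (etrans brf (esym (lc10 f1 f2)))).
have [a10|a1n0] := eqVneq a1 0; last first.
  have {E1} ea2 : a2 = b1 + 1.
    by move/eqP: E1; rewrite mulf_eq0 (negPf a1n0) addrAC subr_eq0 => /eqP.
  have {E2} eb2 : b2 = b1 * (b1 + 1) / a1 by rewrite -E2 mulfK.
  exists (V6 k), (lc f1 f2 a1^-1 0), (lc f1 f2 (b1 / a1) (- 1)); split.
    by apply: frame_change => //; rewrite mul0r subr0 mulrN1 oppr_eq0 invr_eq0.
  by apply: realizesI; rewrite /= ?linE ?(mulE, brE) ?ea2 ?eb2; lc_field.
move/esym/eqP: E2; rewrite {}a10 {E1 tf} in mulE *.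
rewrite mulr0 mulf_eq0 addr_eq0 => /orP[] /eqP b1E; rewrite {}b1E in mulE.
  have [a20|a2n0] := eqVneq a2 0.
    have [b20|b2n0] := eqVneq b2 0.
      exists (V14 (oner_neq0 k)), (lc f1 f2 1 0), (lc f1 f2 0 1); split.
        by rewrite lc10 lc01.
      by apply: realizesI; rewrite /= ?linE ?(mulE, brE) ?a20 ?b20; lc_field.
    exists (V15 k), (lc f1 f2 b2 0), (lc f1 f2 0 1); split.
      by apply: frame_change => //; rewrite mulr1 mulr0 subr0.
    by apply: realizesI; rewrite /= ?linE ?(mulE, brE) ?a20; lc_field.
  have [a21|a2n1] := eqVneq a2 1.
    exists (V8 k), (lc f1 f2 1 0), (lc f1 f2 b2 (- 1)); split.
      by apply: frame_change => //; rewrite mul0r subr0 mul1r oppr_eq0 oner_neq0.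
    by apply: realizesI; rewrite /= ?linE ?(mulE, brE) ?a21; lc_field.
  have c_neq0 : 1 - a2 != 0 by rewrite subr_eq0 eq_sym.
  exists (V14 c_neq0), (lc f1 f2 1 0), (lc f1 f2 (- b2 / a2) 1); split.
    by apply: frame_change => //; rewrite mul0r subr0 mul1r oner_neq0.
  by apply: realizesI; rewrite /= ?linE ?(mulE, brE); lc_field.
have [a21|a2n1] := eqVneq a2 1.
  have [b20|b2n0] := eqVneq b2 0.
    have c_neq0 : - 1 != 0 :> k by rewrite oppr_eq0 oner_neq0.
    exists (V16 c_neq0), (lc f1 f2 1 0), (lc f1 f2 0 1); split.
      by rewrite lc10 lc01.
    by apply: realizesI; rewrite /= ?linE ?(mulE, brE) ?a21 ?b20; lc_field.
  exists (V17 k), (lc f1 f2 b2 0), (lc f1 f2 0 1); split.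
    by apply: frame_change => //; rewrite mulr1 mulr0 subr0.
  by apply: realizesI; rewrite /= ?linE ?(mulE, brE) ?a21; lc_field.
have [a20|a2n0] := eqVneq a2 0.
  exists (V7 k), (lc f1 f2 1 0), (lc f1 f2 (- b2) (- 1)); split.
    by apply: frame_change => //; rewrite mul0r subr0 mul1r oppr_eq0 oner_neq0.
  by apply: realizesI; rewrite /= ?linE ?(mulE, brE) ?a20; lc_field.
have c_neq0 : - a2 != 0 by rewrite oppr_eq0.
have d_neq0 : a2 - 1 != 0 by rewrite subr_eq0.
exists (V16 c_neq0), (lc f1 f2 1 0), (lc f1 f2 (- b2 / (a2 - 1)) 1); split.
  by apply: frame_change => //; rewrite mul0r subr0 mul1r oner_neq0.
by apply: realizesI; rewrite /= ?linE ?(mulE, brE); lc_field.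
Qed.

End Affine.

(** * Zero bracket, noncommutative product *)

(** Vieta: [x] and [y] are the roots of [T^2 - d T - c]. *)
Lemma closed_quadratic (k : closedFieldType) (c d : k) :
  exists x y : k, c = - (x * y) /\ d = x + y.
Proof.
have [x] := @solve_monicpoly k 2 (fun i => if i == 0%N then c else d) isT.
rewrite big_ord_recl big_ord1 /= expr0 expr1 mulr1 => Ex.
exists x, (d - x); split; last by ring.
by transitivity (c + d * x - d * x); [ring | rewrite -Ex; ring].
Qed.

Section Nonabelian.
Variables (k : closedFieldType) (V : lmodType k) (mul br : V -> V -> V).
Hypothesis two_neq0 : 2 != 0 :> k.
Hypothesis plV : post_lie mul br.
Hypothesis br0 : forall x y, br x y = 0.

Let bilm : bilin mul := pl_mul_bilin plV.

(** Axiom (c) says that the matrices [L1 = (-d, c; b, d)] and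
    [L2 = (c - 1, g; d, h)] satisfy [[L1, L2] = L1]; the first equation is the
    vanishing of the determinant of [L1]. *)
Lemma nonabelian_table f1 f2 : frame f1 f2 -> assoc_lie mul br f1 f2 = f1 ->
  exists b c d g h, [/\ table_in mul f1 f2 (- d) b c d (c - 1) d g h,
    d ^+ 2 + b * c = 0, b * g = d * (c + 1), b * (c - 2 - h) + 2 * d ^+ 2 = 0
    & c ^+ 2 + 2 * d * g = h * c].
Proof.
move=> frf lief.
have [a [b [c [d [c' [d' [g [h tf]]]]]]]] := table_exists mul frf.
have [e11 e12 e21 e22] := tf.
have : lc f1 f2 (c - c') (d - d') = lc f1 f2 1 0.
  by rewrite -lcD -lcN -e12 -e21 lc10 -[RHS]lief /assoc_lie br0 addr0.
move=> /(frame_inj frf) [ec ed].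
have {ec}ec : c' = c - 1 by rewrite -ec; ring.
have {ed}ed : d' = d by apply/eqP; rewrite eq_sym -subr_eq0 ed.
rewrite {}ec {}ed {e11 e12 e21 e22} in tf.
have brf : br f1 f2 = lc f1 f2 0 0 by rewrite br0 lc00.
have [] := post_lie_table plV frf tf brf; rewrite !mul0r !addr0.
set X1 := (X in 0 = X -> _); set X2 := (X in _ -> 0 = X -> _).
set X3 := (X in _ -> _ -> 0 = X -> _); set X4 := (X in _ -> _ -> _ -> 0 = X -> _).
move=> E1 E2 E3 E4.
have ea : a = - d.
  transitivity (- d - X1 - X4); first by rewrite /X1 /X4; ring.
  by rewrite -E1 -E4 !subr0.
(* The trace of L1^2 = L1 [L1, L2] vanishes; the Xi are the entries of
   [L1, L2] - L1. *)
have E5 : 2 * (d ^+ 2 + b * c) = 0.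
  transitivity (- (a * X1 + c * X2 + b * X3 + d * X4)).
    by rewrite /X1 /X2 /X3 /X4 ea; ring.
  by rewrite -E1 -E2 -E3 -E4; ring.
rewrite ea in tf; exists b, c, d, g, h; split=> //.
- by apply/eqP; move/eqP: E5; rewrite mulf_eq0 (negPf two_neq0).
- transitivity (d * (c + 1) - X1); first by rewrite /X1 ea; ring.
  by rewrite -E1 subr0.
- by rewrite [RHS]E2 /X2 ea; ring.
- transitivity (h * c - X3); first by rewrite /X3 ea; ring.
  by rewrite -E3 subr0.
Qed.

(** If [b <> 0], the second vector is the square of [s f1], with [s] such that the
    frame stays normalized, [s^2 b = 1].  If [b = 0], then [L1] is strictly triangular
    and [c (c - h) = 0]; a shift by [t] adds [t (2 c - 1 - h)] to [g], so [g] can be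
    killed unless [c = 0, h = -1] or [c = h = 1]. *)
Lemma nonabelian_normal_form f1 f2 :
  frame f1 f2 -> assoc_lie mul br f1 f2 = f1 ->
  exists m g1 g2, frame g1 g2 /\ realizes mul br g1 g2 m.
Proof.
move=> frf lief.
have [b [c [d [g [h [tf E1 E2 E3 E4]]]]]] := nonabelian_table frf lief.
have mulE := bilin_table bilm tf.
have [b0|bn0] := eqVneq b 0; last first.
  have [s [s' [es es']]] := closed_quadratic b^-1 0.
  have {es'}es' : s' = - s by apply/eqP; rewrite -addr_eq0 addrC -es'.
  rewrite {}es' mulrN opprK in es.
  have sn0 : s != 0.
    apply: contraNneq bn0 => s0; move/eqP: es.
    by rewrite s0 mul0r invr_eq0.
  have eb : b = (s * s)^-1 by rewrite -es invrK.
  have ec : c = - (d ^+ 2 / b).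
    transitivity ((d ^+ 2 + b * c) / b - d ^+ 2 / b); first by field.
    by rewrite E1 mul0r sub0r.
  have eg : g = d * (c + 1) / b by rewrite -E2 mulrC mulKf.
  have eh : h = c - 2 + 2 * d ^+ 2 / b.
    transitivity (c - 2 + 2 * d ^+ 2 / b - (b * (c - 2 - h) + 2 * d ^+ 2) / b).
      by field.
    by rewrite E3 mul0r subr0.
  exists (V12 k), (lc f1 f2 s 0), (lc f1 f2 (- d / b) 1); split.
    by apply: frame_change => //; rewrite mul0r subr0 mulr1.
  rewrite {E1 E2 E3 E4 tf es}.
  by apply: realizesI; rewrite /= ?linE ?br0 // ?mulE ?eh ?eg ?ec ?eb; lc_field.
have d0 : d = 0.
  by move/eqP: E1; rewrite b0 mul0r addr0 expf_eq0 => /eqP.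
move/eqP: E4; rewrite {E1 E2 E3 tf}b0 {}d0 in mulE *.
rewrite mulr0 mul0r addr0 expr2 -subr_eq0 -mulrBl mulf_eq0 => /orP[|/eqP c0].
  rewrite subr_eq0 => /eqP eh; rewrite -{h}eh in mulE.
  have [c0|cn0] := eqVneq c 0.
    exists (V9 0), (lc f1 f2 1 0), (lc f1 f2 g 1); split.
      by apply: frame_change => //; rewrite mul0r subr0 mul1r oner_neq0.
    by apply: realizesI; rewrite /= ?linE ?br0 // ?mulE ?c0; lc_field.
  have [c1|cn1] := eqVneq c 1.
    have [g0|gn0] := eqVneq g 0.
      exists (V10 (oner_neq0 k)), (lc f1 f2 1 0), (lc f1 f2 0 1); split.
        by rewrite lc10 lc01.
      by apply: realizesI; rewrite /= ?linE ?br0 // ?mulE ?c1 ?g0; lc_field.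
    exists (V13 k), (lc f1 f2 g 0), (lc f1 f2 0 1); split.
      by apply: frame_change => //; rewrite mulr1 mulr0 subr0.
    by apply: realizesI; rewrite /= ?linE ?br0 // ?mulE ?c1; lc_field.
  have d_neq0 : c - 1 != 0 by rewrite subr_eq0.
  exists (V10 cn0), (lc f1 f2 1 0), (lc f1 f2 (- g / (c - 1)) 1); split.
    by apply: frame_change => //; rewrite mul0r subr0 mul1r oner_neq0.
  by apply: realizesI; rewrite /= ?linE ?br0 // ?mulE; lc_field.
rewrite {}c0 in mulE.
have [hN1|hn] := eqVneq h (- 1).
  have [g0|gn0] := eqVneq g 0.
    exists (V9 (-1)), (lc f1 f2 1 0), (lc f1 f2 0 1); split.
      by rewrite lc10 lc01.
    by apply: realizesI; rewrite /= ?linE ?br0 // ?mulE ?hN1 ?g0; lc_field.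
  exists (V11 k), (lc f1 f2 g 0), (lc f1 f2 0 1); split.
    by apply: frame_change => //; rewrite mulr1 mulr0 subr0.
  by apply: realizesI; rewrite /= ?linE ?br0 // ?mulE ?hN1; lc_field.
have d_neq0 : 1 + h != 0 by rewrite addrC addr_eq0.
exists (V9 h), (lc f1 f2 1 0), (lc f1 f2 (g / (1 + h)) 1); split.
  by apply: frame_change => //; rewrite mul0r subr0 mul1r oner_neq0.
by apply: realizesI; rewrite /= ?linE ?br0 // ?mulE; lc_field.
Qed.

End Nonabelian.

(** * Zero bracket, commutative product *)

Section Commutative.
Variables (k : closedFieldType) (V : lmodType k) (mul br : V -> V -> V).
Hypothesis two_neq0 : 2 != 0 :> k.
Hypothesis plV : post_lie mul br.
Hypothesis br0 : forall x y, br x y = 0.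
Hypothesis mulC : forall x y, mul x y = mul y x.

Let bilm : bilin mul := pl_mul_bilin plV.

Lemma commutative_table (f1 f2 : V) a b c d g h : frame f1 f2 ->
  table_in mul f1 f2 a b c d c d g h ->
  [/\ d * c = b * g, d ^+ 2 + b * c = a * d + b * h & c ^+ 2 + d * g = g * a + h * c].
Proof.
move=> frf tf; have brf : br f1 f2 = lc f1 f2 0 0 by rewrite br0 lc00.
have [] := post_lie_table plV frf tf brf; rewrite !mul0r !addr0 => E1 E2 E3 _.
split; apply/eqP; rewrite -subr_eq0.
- by apply/eqP; rewrite [RHS]E1; ring.
- by apply/eqP; rewrite [RHS]E2; ring.
- by rewrite -oppr_eq0; apply/eqP; rewrite [RHS]E3; ring.
Qed.

(** The determinant of [x, x.x] is a binary cubic form in the coordinates of [x].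
    If it vanishes at [(1,0)], [(0,1)], [(1,1)] and [(1,-1)], it is zero, which means
    [x.x = 2 l(x) x] for the linear form [l = (d, c)]; associativity then forces
    [l = 0]. *)
Lemma square_frame_or_zero (f1 f2 : V) : frame f1 f2 ->
  (exists x : V, frame x (mul x x)) \/ (forall x y, mul x y = 0).
Proof.
move=> frf.
have [a [b [c [d [c' [d' [g [h tf]]]]]]]] := table_exists mul frf.
have [e11 e12 e21 e22] := tf.
have [ec ed] : c' = c /\ d' = d by apply: (frame_inj frf); rewrite -e12 -e21 mulC.
rewrite {}ec {}ed {e11 e12 e21 e22} in tf.
have mulE := bilin_table bilm tf.
have [E1 E2 E3] := commutative_table frf tf.
have square_frame p q :
    p * (p * p * b + p * q * d + q * p * d + q * q * h)
      - q * (p * p * a + p * q * c + q * p * c + q * q * g) != 0 ->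
    exists x : V, frame x (mul x x).
  move=> D0; exists (lc f1 f2 p q); rewrite mulE; exact: frame_change.
have [b0|bn0] := eqVneq b 0; last first.
  by left; apply: (square_frame 1 0); rewrite !(mul0r, mulr0, mul1r, addr0, subr0).
have [g0|gn0] := eqVneq g 0; last first.
  left; apply: (square_frame 0 1).
  by rewrite !(mul0r, mulr0, mul1r, addr0, add0r, sub0r) oppr_eq0.
have [P0|Pn0] := eqVneq (2 * d - a + (h - 2 * c)) 0; last first.
  left; apply: (square_frame 1 1).
  by apply: contraNneq Pn0 => e; apply/eqP; rewrite -[RHS]e b0 g0; ring.
have [Q0|Qn0] := eqVneq (2 * d - a - (h - 2 * c)) 0; last first.
  left; apply: (square_frame 1 (- 1)).
  by apply: contraNneq Qn0 => e; rewrite -oppr_eq0; apply/eqP; rewrite -[RHS]e b0 g0; ring.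
right.
have ea : a = 2 * d.
  apply/eqP; rewrite eq_sym -subr_eq0 -(inj_eq (mulfI two_neq0)) mulr0.
  by apply/eqP; transitivity (0 + 0 : k); [rewrite -{1}P0 -Q0; ring | rewrite addr0].
have eh : h = 2 * c.
  by apply/eqP; rewrite -subr_eq0 -[0]P0 ea; apply/eqP; ring.
have d0 : d = 0.
  apply/eqP; rewrite -sqrf_eq0; apply/eqP.
  transitivity (a * d + b * h - (d ^+ 2 + b * c)); first by rewrite ea b0; ring.
  by rewrite E2 subrr.
have c0 : c = 0.
  apply/eqP; rewrite -sqrf_eq0; apply/eqP.
  transitivity (g * a + h * c - (c ^+ 2 + d * g)); first by rewrite eh g0; ring.
  by rewrite E3 subrr.
move=> x y; have [p [q ->]] := frf.1 x; have [r [s ->]] := frf.1 y.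
by rewrite mulE ea eh b0 g0 c0 d0; lc_field.
Qed.

(** In the frame [(x, x^2)] one has [x^3 = (u + v) x^2 - u v x], so that [V] is the
    ideal [(T)] of [k[T]/(T(T-u)(T-v))].  The new frames consist of idempotents
    when [u], [v] and [0] are distinct (V3), of an idempotent at the nonzero root and
    an annihilator when exactly one root is zero (V2), of a nilpotent element and
    the unit when [u = v <> 0] (V4), and of [T^2] and [T] when [u = v = 0] (V5). *)
Lemma commutative_normal_form (f1 f2 : V) : frame f1 f2 ->
  exists m g1 g2, frame g1 g2 /\ realizes mul br g1 g2 m.
Proof.
move=> frf; have [[x frx]|mul0] := square_frame_or_zero frf; last first.
  exists (V1 k), f1, f2; split=> //.
  by apply: realizesI; rewrite /= ?linE ?mul0 ?br0.
have [c [d [c' [d' [g [h tx]]]]]] : exists c d c' d' g h,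
    table_in mul x (mul x x) 0 1 c d c' d' g h.
  have [a [b [c [d [c' [d' [g [h [e11 e12 e21 e22]]]]]]]]] := table_exists mul frx.
  by exists c, d, c', d', g, h; split=> //; rewrite lc01.
have {}tx : table_in mul x (mul x x) 0 1 c d c d g h.
  by case: tx => e11 e12 _ e22; split=> //; rewrite mulC.
have [E1 E2 _] := commutative_table frx tx.
have eg : g = d * c by rewrite E1 mul1r.
have eh : h = d ^+ 2 + c by rewrite -[c]mul1r E2; ring.
have {tx E1 E2}mulE := bilin_table bilm tx; rewrite {}eg {}eh in mulE.
have [u [v [ec ed]]] := closed_quadratic c d.
(* The roots play symmetric roles. *)
wlog uv0 : u v ec ed / u = 0 -> v = 0.
  move=> main; have [u0|un0] := eqVneq u 0; last first.
    by apply: (main u v) => // u0; rewrite u0 eqxx in un0.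
  by apply: (main v u); rewrite 1?mulrC 1?addrC.
rewrite {}ec {}ed in mulE.
have [u0|un0] := eqVneq u 0.
  exists (V5 k), (lc x (mul x x) 0 1), (lc x (mul x x) 1 0); split.
    by apply: frame_change; rewrite // mul0r sub0r mul1r oppr_eq0 oner_neq0.
  by apply: realizesI; rewrite /= ?linE ?br0 // ?mulE ?uv0 ?u0 //; lc_field.
have [v0|vn0] := eqVneq v 0.
  exists (V2 k), (lc x (mul x x) 0 (u ^- 2)), (lc x (mul x x) (- u) 1); split.
    apply: frame_change => //; rewrite mul0r sub0r mulrN opprK mulf_neq0 //.
    by rewrite invr_eq0 expf_neq0.
  by apply: realizesI; rewrite /= ?linE ?br0 // ?mulE ?v0; lc_field.
have [uv|uvn] := eqVneq u v.
  exists (V4 k), (lc x (mul x x) (- u) 1), (lc x (mul x x) (2 / u) (- u ^- 2)); split.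
    apply: frame_change => //; have -> : - u * - u ^- 2 - 1 * (2 / u) = - u^-1 by field.
    by rewrite oppr_eq0 invr_eq0.
  by apply: realizesI; rewrite /= ?linE ?br0 // ?mulE -?uv; lc_field.
have w0 : u - v != 0 by rewrite subr_eq0.
have w0' : v - u != 0 by rewrite subr_eq0 eq_sym.
exists (V3 k), (lc x (mul x x) (- v / (u * (u - v))) (u * (u - v))^-1),
  (lc x (mul x x) (- u / (v * (v - u))) (v * (v - u))^-1); split.
  apply: frame_change => //.
  have -> : - v / (u * (u - v)) * (v * (v - u))^-1
      - (u * (u - v))^-1 * (- u / (v * (v - u))) = - (u * v * (u - v))^-1.
    by field; rewrite un0 vn0 w0.
  by rewrite oppr_eq0 invr_eq0 !mulf_neq0.
by apply: realizesI; rewrite /= ?linE ?br0 // ?mulE; lc_field; rewrite ?un0 ?vn0 ?w0 ?w0'.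
Qed.

End Commutative.

(** * Existence *)

Lemma post_lie_normal_form (k : closedFieldType) (V : lmodType k) (mul br : V -> V -> V)
    (f1 f2 : V) :
  2 != 0 :> k -> post_lie mul br -> frame f1 f2 ->
  exists m g1 g2, frame g1 g2 /\ realizes mul br g1 g2 m.
Proof.
move=> two_neq0 plV frf.
have bilb := pl_br_bilin plV; have altb := br_alternating two_neq0 plV.
have bila := assoc_lie_bilin plV; have alta := assoc_lie_alternating two_neq0 plV.
have [b0|bn0] := eqVneq (br f1 f2) 0; last first.
  have [g1 [g2 [frg brg]]] := alternating_frame bilb altb frf bn0.
  have [a1 [b1 [a2 [b2 [affg E1 E2]]]]] := affine_frame_exists two_neq0 plV frg brg.
  exact: affine_normal_form affg E1 E2.
have br0 x y : br x y = 0.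
  have [p [q ->]] := frf.1 x; have [r [s ->]] := frf.1 y.
  by rewrite alternating_lc // b0 scaler0.
have [l0|ln0] := eqVneq (assoc_lie mul br f1 f2) 0; last first.
  have [g1 [g2 [frg lieg]]] := alternating_frame bila alta frf ln0.
  exact: nonabelian_normal_form frg lieg.
apply: commutative_normal_form (frf) => // x y.
have : assoc_lie mul br x y = 0.
  have [p [q ->]] := frf.1 x; have [r [s ->]] := frf.1 y.
  by rewrite alternating_lc // l0 scaler0.
by rewrite /assoc_lie br0 addr0 => /subr0_eq.
Qed.

Lemma frame_exists (k : fieldType) (V : vectType k) :
  \dim {:V} = 2%N -> exists f1 f2 : V, frame f1 f2.
Proof.
move=> dimV.
have [X basX] : exists X : 2.-tuple V, basis_of {:V} X.
  by rewrite -dimV; exists (vbasis {:V}); apply: vbasisP.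
exists X`_0, X`_1; split=> [v|a b e].
  exists (coord X ord0 v), (coord X (lift ord0 ord0) v).
  by rewrite {1}(coord_basis basX (memvf v)) big_ord_recl big_ord1.
have /freeP freeX := basis_free basX.
have := freeX (fun i => if i == ord0 then a else b).
rewrite big_ord_recl big_ord1 /= => /(_ e) ab0.
by split; [apply: (ab0 ord0) | apply: (ab0 (lift ord0 ord0))].
Qed.

(** * The tables satisfy the axioms *)

Section Tables.
Variable k : fieldType.
Implicit Types m : pl_index k.

Lemma row2P (u w : 'rV[k]_2) : u 0 0 = w 0 0 -> u 0 1 = w 0 1 -> u = w.
Proof. by move=> e0 e1; rewrite (row_lc u) (row_lc w) e0 e1. Qed.

Lemma pl_mul_bilinear m : bilin (pl_mul m).
Proof.
by split=> z a x y; apply: row2P; rewrite /pl_mul !mxE; ring.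
Qed.

Lemma pl_br_bilinear m : bilin (pl_br m).
Proof.
by split=> z a x y; apply: row2P; rewrite /pl_br !mxE; ring.
Qed.

Lemma pl_frame : frame (e1 k) (e2 k).
Proof.
split=> [w|a b]; first by exists (w 0 0), (w 0 1); apply: row_lc.
by rewrite lc_e => /rowP e; move: (e 0) (e 1); rewrite !mxE.
Qed.

Lemma pl_post_lie m : post_lie (pl_mul m) (pl_br m).
Proof.
have [e11 e12 e21 e22] := pl_mul_e m.
have pl_table : table_in (pl_mul m) (e1 k) (e2 k)
    (t_11 (table m) 0 0) (t_11 (table m) 0 1) (t_12 (table m) 0 0) (t_12 (table m) 0 1)
    (t_21 (table m) 0 0) (t_21 (table m) 0 1) (t_22 (table m) 0 0) (t_22 (table m) 0 1).
  by rewrite /table_in e11 e12 e21 e22; split; apply: row_lc.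
apply: post_lie_of_table pl_frame pl_table (etrans (pl_br_e m) (row_lc _)) _ _.
- exact: pl_mul_bilinear.
- exact: pl_br_bilinear.
- by move=> x; apply: row2P; rewrite /pl_br !mxE; ring.
- by split; case: m {e11 e12 e21 e22} => [||||||||a|a an0||||a an0||a an0|];
  rewrite /= !mxE /=; ring.
- by split; case: m {e11 e12 e21 e22} => [||||||||a|a an0||||a an0||a an0|];
  rewrite /= !mxE /=; ring.
Qed.

Lemma pl_assoc_lie m :
  assoc_lie (pl_mul m) (pl_br m) (e1 k) (e2 k) = t_lie (table m).
Proof.
have [_ e12 e21 _] := pl_mul_e m; rewrite /assoc_lie e12 e21 pl_br_e.
by case: m {e12 e21} => [||||||||a|a an0||||a an0||a an0|]; apply: row2P;
  rewrite /= !mxE /=; ring.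
Qed.

End Tables.

(** * Invariants *)

Section Invariants.
Variables (k : fieldType) (V : lmodType k) (mul br : V -> V -> V).
Hypothesis two_neq0 : 2 != 0 :> k.
Hypothesis plV : post_lie mul br.

Let bilm : bilin mul := pl_mul_bilin plV.
Let bilb : bilin br := pl_br_bilin plV.
Let altb : alternating br := br_alternating two_neq0 plV.
Let bila : bilin (assoc_lie mul br) := assoc_lie_bilin plV.
Let alta : alternating (assoc_lie mul br) := assoc_lie_alternating two_neq0 plV.

Lemma frame_neq0 (f1 f2 : V) : frame f1 f2 -> f1 != 0 /\ f2 != 0.
Proof.
move=> [_ free_f]; split; apply/eqP => f0.
  have [/eqP] : 1 = 0 :> k /\ 0 = 0 :> k by apply: free_f; rewrite lc10.
  by rewrite oner_eq0.
have [_ /eqP] : 0 = 0 :> k /\ 1 = 0 :> k by apply: free_f; rewrite lc01.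
by rewrite oner_eq0.
Qed.

(** One constructor for each of the three cases.  In the first two, [None]
    stands for the single algebra with [a1 <> 0] (V6) or [b <> 0] (V12). *)
Inductive pl_invariant : Type :=
  | Affine of option (k * k * bool)
  | Nonabelian of option (k * k * bool)
  | Commutative of bool & bool & bool & bool.

(** When [a1 = 0] the scalars [b1] and [a2] do not change with the frame; when
    moreover [b1 + a2 = 0], [b2] is only rescaled, so that its vanishing is intrinsic. *)
Definition affine_invariant (a1 b1 a2 b2 : k) : option (k * k * bool) :=
  if a1 == 0 then Some (b1, a2, (b1 + a2 == 0) && (b2 != 0)) else None.

(** The shape common to V9, ..., V13: in the basis of V12 one has [b = 1] and
    [c = g = 0], in the other ones [b = 0]. *)
Definition nonabelian_frame (f1 f2 : V) (b c g h : k) : Prop :=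
  [/\ frame f1 f2, assoc_lie mul br f1 f2 = f1
    & table_in mul f1 f2 0 b c 0 (c - 1) 0 g h].

(** When [b = 0] the scalars [c] and [h] do not change with the frame, and [g] is
    only rescaled if [2 c - 1 - h = 0]. *)
Definition nonabelian_invariant (b c g h : k) : option (k * k * bool) :=
  if b == 0 then Some (c, h, (2 * c - 1 - h == 0) && (g != 0)) else None.

(** In the commutative case no frame is canonical, but these four properties of the
    product suffice to tell V1, V2, V3, V4 and V5 apart. *)
Definition has_invariant (i : pl_invariant) : Prop :=
  match i with
  | Affine j => exists f1 f2 a1 b1 a2 b2,
      affine_frame mul br f1 f2 a1 b1 a2 b2 /\ j = affine_invariant a1 b1 a2 b2
  | Nonabelian j => (forall x y, br x y = 0) /\ exists f1 f2 b c g h,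
      nonabelian_frame f1 f2 b c g h /\ j = nonabelian_invariant b c g h
  | Commutative z n i a =>
      ((forall x y, br x y = 0) /\ (forall x y, assoc_lie mul br x y = 0)) /\
      [/\ z <-> (forall x y, mul x y = 0),
          n <-> (exists x, x != 0 /\ mul x x = 0),
          i <-> (exists x, x != 0 /\ mul x x = x)
        & a <-> (exists x, x != 0 /\ forall y, mul x y = 0)]
  end.

Lemma affine_invariant_unique f1 f2 a1 b1 a2 b2 g1 g2 a1' b1' a2' b2' :
  affine_frame mul br f1 f2 a1 b1 a2 b2 ->
  affine_frame mul br g1 g2 a1' b1' a2' b2' ->
  affine_invariant a1 b1 a2 b2 = affine_invariant a1' b1' a2' b2'.
Proof.
move=> [frf brf tf] [frg brg [e11 e12 e21 e22]].
have mulE := bilin_table bilm tf.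
have [s [t [sn0 eg1 eg2]]] := alternating_frame_unique bilb altb frf brf frg brg.
move: e11 e12 e21 e22; rewrite {}eg1 {}eg2 !mulE !lc_lc.
move=> /(frame_inj frf) [e11 _] /(frame_inj frf) [e12 _].
move=> /(frame_inj frf) [e21 _] /(frame_inj frf) [e22 _].
have {e11}e11 : a1' = s * a1.
  by apply: (mulIf sn0); transitivity (a1' * s + 0 * t); [ring | rewrite -e11; ring].
have {e12}e12 : b1' = b1 + t * a1.
  by apply: (mulIf sn0); transitivity (b1' * s + 0 * t); [ring | rewrite -e12; ring].
have {e21}e21 : a2' = a2 + t * a1.
  by apply: (mulIf sn0); transitivity (a2' * s + 0 * t); [ring | rewrite -e21; ring].
have {e22}e22 : b2' * s = b2 + t * (b1 + a2) + t ^+ 2 * a1.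
  by transitivity (b2' * s + 0 * t); [ring | rewrite -e22; ring].
rewrite /affine_invariant e11 mulf_eq0 (negPf sn0) /=.
have [a10|//] := eqVneq a1 0.
rewrite {}e12 {}e21 a10 !mulr0 !addr0 in e22 *.
congr (Some (_, _, _)); have [e|//] := eqVneq (b1 + a2) 0.
rewrite e mulr0 addr0 in e22.
by rewrite /= -e22 mulf_eq0 (negPf sn0) orbF.
Qed.

Lemma nonabelian_invariant_unique f1 f2 b c g h g1 g2 b' c' g' h' :
  nonabelian_frame f1 f2 b c g h -> nonabelian_frame g1 g2 b' c' g' h' ->
  nonabelian_invariant b c g h = nonabelian_invariant b' c' g' h'.
Proof.
move=> [frf lief tf] [frg lieg [e11 e12 _ e22]].
have mulE := bilin_table bilm tf.
have [s [t [sn0 eg1 eg2]]] := alternating_frame_unique bila alta frf lief frg lieg.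
move: e11 e12 e22; rewrite {}eg1 {}eg2 !mulE !lc_lc.
move=> /(frame_inj frf) [_ e11] /(frame_inj frf) [e12 e12'].
move=> /(frame_inj frf) [e22 e22'].
have {e11}e11 : b' = s ^+ 2 * b.
  by transitivity (0 * 0 + b' * 1 : k); [ring | rewrite -e11; ring].
rewrite /nonabelian_invariant e11 mulf_eq0 expf_eq0 (negPf sn0) /=.
have [b0|//] := eqVneq b 0.
have {e12}e12 : c' = c.
  apply: (mulIf sn0); transitivity (c' * s + 0 * t); first by ring.
  by rewrite -e12; ring.
have {e22'}eh : h' = h.
  by transitivity (g' * 0 + h' * 1 : k); [ring | rewrite -e22' b0; ring].
have {}e22 : g' * s = g + t * (2 * c - 1 - h).
  transitivity (g' * s + h' * t - h' * t); first by ring.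
  by rewrite -e22 eh; ring.
rewrite e12 eh; congr (Some (_, _, _)); have [e|//] := eqVneq (2 * c - 1 - h) 0.
rewrite e mulr0 addr0 in e22.
by rewrite /= -e22 mulf_eq0 (negPf sn0) orbF.
Qed.

Lemma truth_unique (P : Prop) (b b' : bool) : (b <-> P) -> (b' <-> P) -> b = b'.
Proof. by move=> r r'; apply/idP/idP => [/r /r'|/r' /r]. Qed.

Lemma invariant_unique i j : has_invariant i -> has_invariant j -> i = j.
Proof.
case: i => [i|i|z n i a]; case: j => [j|j|z' n' i' a'] /=.
- move=> [f1 [f2 [a1 [b1 [a2 [b2 [aff ->]]]]]]] [g1 [g2 [a1' [b1' [a2' [b2' [affg ->]]]]]]].
  by rewrite (affine_invariant_unique aff affg).
- move=> [f1 [f2 [a1 [b1 [a2 [b2 [[frf brf _] _]]]]]]] [br0 _].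
  by case/frame_neq0: frf; rewrite -brf br0 eqxx.
- move=> [f1 [f2 [a1 [b1 [a2 [b2 [[frf brf _] _]]]]]]] [[br0 _] _].
  by case/frame_neq0: frf; rewrite -brf br0 eqxx.
- move=> [br0 _] [f1 [f2 [a1 [b1 [a2 [b2 [[frf brf _] _]]]]]]].
  by case/frame_neq0: frf; rewrite -brf br0 eqxx.
- move=> [_ [f1 [f2 [b [c [g [h [nab ->]]]]]]]] [_ [g1 [g2 [b' [c' [g' [h' [nabg ->]]]]]]]].
  by rewrite (nonabelian_invariant_unique nab nabg).
- move=> [_ [f1 [f2 [b [c [g [h [[frf lief _] _]]]]]]]] [[_ lie0] _].
  by case/frame_neq0: frf; rewrite -lief lie0 eqxx.
- move=> [[br0 _] _] [f1 [f2 [a1 [b1 [a2 [b2 [[frf brf _] _]]]]]]].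
  by case/frame_neq0: frf; rewrite -brf br0 eqxx.
- move=> [[_ lie0] _] [_ [f1 [f2 [b [c [g [h [[frf lief _] _]]]]]]]].
  by case/frame_neq0: frf; rewrite -lief lie0 eqxx.
move=> [_ [rz rn ri ra]] [_ [rz' rn' ri' ra']].
by rewrite (truth_unique rz rz') (truth_unique rn rn') (truth_unique ri ri')
  (truth_unique ra ra').
Qed.

End Invariants.

(** The values of the invariant on the tables; the brackets [-e1] are turned into
    [e1] by reversing [e2]. *)
Definition invariant (k : fieldType) (m : pl_index k) : pl_invariant k :=
  match m with
  | V1 => Commutative k true true false true
  | V2 => Commutative k false true true true
  | V3 => Commutative k false false true false
  | V4 => Commutative k false true true false
  | V5 => Commutative k false true false true
  | V6 => Affine None
  | V7 => Affine (Some (- 1, 0, false))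
  | V8 => Affine (Some (0, 1, false))
  | V9 a => Nonabelian (Some (0, a, false))
  | V10 b _ => Nonabelian (Some (b, b, false))
  | V11 => Nonabelian (Some (0, - 1, true))
  | V12 => Nonabelian None
  | V13 => Nonabelian (Some (1, 1, true))
  | V14 a _ => Affine (Some (0, 1 - a, false))
  | V15 => Affine (Some (0, 0, true))
  | V16 a _ => Affine (Some (- 1, - a, false))
  | V17 => Affine (Some (- 1, 1, true))
  end.

Lemma invariant_inj (k : fieldType) : injective (@invariant k).
Proof.
have one0 : 1 <> 0 :> k by apply/eqP/oner_neq0.
have N1_0 : - 1 <> 0 :> k by apply/eqP; rewrite oppr_eq0 oner_neq0.
have neq (a : k) : a != 0 -> [/\ a <> 0, - a <> 0 & 1 - a <> 1].
  move=> an0; split; apply/eqP=> //; first by rewrite oppr_eq0.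
  by apply: contraNneq an0 => e; rewrite -oppr_eq0; apply/eqP/(addrI 1); rewrite e addr0.
move=> m m'; case: m => [||||||||a|a an0||||a an0||a an0|];
  case: m' => [||||||||a'|a' an0'||||a' an0'||a' an0'|] //=;
  try congruence.
- by case=> /esym; case: (neq _ an0').
- by case=> /esym; case: (neq _ an0').
- by case=> /esym; case: (neq _ an0').
- by case; case: (neq _ an0).
- by case=> e; move: an0 an0'; rewrite e => an0 an0'; rewrite (bool_irrelevance an0 an0').
- by case; case: (neq _ an0).
- case=> /(addrI 1)/oppr_inj e; move: an0 an0'; rewrite e => an0 an0'.
  by rewrite (bool_irrelevance an0 an0').
- by case; case: (neq _ an0).
case=> /oppr_inj e; move: an0 an0'; rewrite e => an0 an0'.
by rewrite (bool_irrelevance an0 an0').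
Qed.

Section RealizedInvariant.
Variables (k : fieldType) (V : lmodType k) (mul br : V -> V -> V).
Hypothesis two_neq0 : 2 != 0 :> k.
Hypothesis plV : post_lie mul br.

Let bilm : bilin mul := pl_mul_bilin plV.
Let bilb : bilin br := pl_br_bilin plV.
Let altb : alternating br := br_alternating two_neq0 plV.
Let bila : bilin (assoc_lie mul br) := assoc_lie_bilin plV.
Let alta : alternating (assoc_lie mul br) := assoc_lie_alternating two_neq0 plV.

Lemma affine_of_frame j (f1 f2 : V) a1 b1 a2 b2 :
  frame f1 f2 -> br f1 f2 = f1 -> mul f1 f1 = lc f1 f2 a1 0 ->
  mul f1 f2 = lc f1 f2 b1 0 -> mul f2 f1 = lc f1 f2 a2 0 -> mul f2 f2 = lc f1 f2 b2 0 ->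
  affine_invariant a1 b1 a2 b2 = j -> has_invariant mul br (Affine j).
Proof. by move=> *; exists f1, f2, a1, b1, a2, b2. Qed.

(** The frame [(f1, -f2)] is normalized. *)
Lemma affine_of_opposite_frame j (f1 f2 : V) a1 b1 a2 :
  frame f1 f2 -> br f1 f2 = - f1 -> mul f1 f1 = lc f1 f2 a1 0 ->
  mul f1 f2 = lc f1 f2 b1 0 -> mul f2 f1 = lc f1 f2 a2 0 -> mul f2 f2 = 0 ->
  affine_invariant a1 (- b1) (- a2) 0 = j -> has_invariant mul br (Affine j).
Proof.
move=> frf brf e11 e12 e21 e22 <-.
have tf : table_in mul f1 f2 a1 0 b1 0 a2 0 0 0 by split; rewrite // e22 lc00.
have mulE := bilin_table bilm tf.
apply: (@affine_of_frame _ (lc f1 f2 1 0) (lc f1 f2 0 (- 1)) a1 (- b1) (- a2) 0).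
- by apply: frame_change => //; rewrite mul0r subr0 mul1r oppr_eq0 oner_neq0.
- by rewrite alternating_lc // brf mul0r subr0 mul1r scaleN1r opprK lc10.
1-4: by rewrite mulE lc_lc; lc_field.
by [].
Qed.

Lemma nonabelian_of_frame j (f1 f2 : V) b c g h :
  frame f1 f2 -> br f1 f2 = 0 -> mul f1 f1 = lc f1 f2 0 b ->
  mul f1 f2 = lc f1 f2 c 0 -> mul f2 f1 = lc f1 f2 (c - 1) 0 -> mul f2 f2 = lc f1 f2 g h ->
  nonabelian_invariant b c g h = j -> has_invariant mul br (Nonabelian j).
Proof.
move=> frf brf e11 e12 e21 e22 <-; split.
  move=> x y; have [p [q ->]] := frf.1 x; have [r [s ->]] := frf.1 y.
  by rewrite alternating_lc // brf scaler0.
exists f1, f2, b, c, g, h; split=> //; split=> //.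
rewrite /assoc_lie e12 e21 brf addr0 lcN lcD -[RHS](lc10 f1 f2).
by apply: lc_eq; ring.
Qed.

Lemma commutative_of_frame (f1 f2 : V) (z n i a : bool) :
  frame f1 f2 -> br f1 f2 = 0 -> mul f1 f2 = mul f2 f1 ->
  [/\ z <-> (forall x y, mul x y = 0),
      n <-> (exists x, x != 0 /\ mul x x = 0),
      i <-> (exists x, x != 0 /\ mul x x = x)
    & a <-> (exists x, x != 0 /\ forall y, mul x y = 0)] ->
  has_invariant mul br (Commutative k z n i a).
Proof.
move=> frf brf mulC flags; split=> //; split=> x y.
  have [p [q ->]] := frf.1 x; have [r [s ->]] := frf.1 y.
  by rewrite alternating_lc // brf scaler0.
have [p [q ->]] := frf.1 x; have [r [s ->]] := frf.1 y.
by rewrite alternating_lc // /assoc_lie mulC brf subrr addr0 scaler0.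
Qed.

Local Ltac lc_table e11 e12 e21 e22 :=
  by rewrite ?e11 ?e12 ?e21 ?e22 /lc
    ?(sub0r, subrr, scale0r, scale1r, scaleN1r, addr0, add0r).

Local Ltac invariant_simp :=
  rewrite /affine_invariant /nonabelian_invariant
    ?(eqxx, oner_eq0, andbF, andbT, oppr0, opprK, addr0, addNr, mulr0, sub0r, subrr).

Lemma realizes_invariant (f1 f2 : V) m :
  frame f1 f2 -> realizes mul br f1 f2 m -> has_invariant mul br (invariant m).
Proof.
move=> frf [[e11 e12 e21 e22] ebr].
have {}e11 : mul f1 f1 = lin f1 f2 (t_11 (table m)) by [].
have {}e12 : mul f1 f2 = lin f1 f2 (t_12 (table m)) by [].
have {}e21 : mul f2 f1 = lin f1 f2 (t_21 (table m)) by [].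
have {}e22 : mul f2 f2 = lin f1 f2 (t_22 (table m)) by [].
have [f1n0 f2n0] := frame_neq0 frf.
case: m e11 e12 e21 e22 ebr
  => [||||||||a|a an0||||a an0||a an0|] e11 e12 e21 e22 ebr;
  rewrite /= ?linE in e11 e12 e21 e22 ebr; rewrite [invariant _]/=.
- apply: (commutative_of_frame frf) => //; first by rewrite e12.
  have mul0 x y : mul x y = 0.
    have [p [q ->]] := frf.1 x; have [r [s ->]] := frf.1 y.
    by rewrite bilin_lc // e11 e12 e21 e22 !scaler0 !addr0.
  split; split=> //; try by exists f1.
  by case=> x [xn0]; rewrite mul0 => x0; rewrite -x0 eqxx in xn0.
- apply: (commutative_of_frame frf) => //; first by rewrite e12.
  split; split=> //.
  + by move/(_ f1 f1)/eqP; rewrite e11 (negPf f1n0).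
  + by exists f2.
  + by exists f1.
  + move=> _; exists f2; split=> // y; have [r [s ->]] := frf.1 y.
    by rewrite (linear_lc _ _ _ _ (bilm.2 f2)) e21 e22 !scaler0 addr0.
- apply: (commutative_of_frame frf) => //; first by rewrite e12.
  have tf : table_in mul f1 f2 1 0 0 0 0 0 0 1 by split; rewrite ?(lc10, lc01, lc00).
  have mulE := bilin_table bilm tf.
  split; split=> //.
  + by move/(_ f1 f1)/eqP; rewrite e11 (negPf f1n0).
  + case=> x [xn0]; have [p [q ex]] := frf.1 x; rewrite ex mulE => /frf.2 [].
    rewrite !(mulr0, addr0, add0r, mulr1) => /eqP + /eqP.
    rewrite !mulf_eq0 !orbb => /eqP p0 /eqP q0.
    by rewrite ex p0 q0 lc00 eqxx in xn0.
  + by exists f1.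
  + case=> x [xn0]; have [p [q ex]] := frf.1 x => ann; move: (ann f1) (ann f2).
    rewrite ex !bilin_lcl // e11 e12 e21 e22 !scaler0 addr0 add0r => /eqP + /eqP.
    rewrite !scaler_eq0 (negPf f1n0) (negPf f2n0) !orbF => /eqP p0 /eqP q0.
    by rewrite ex p0 q0 lc00 eqxx in xn0.
- apply: (commutative_of_frame frf) => //; first by rewrite e12.
  split; split=> //.
  + by move/(_ f2 f2)/eqP; rewrite e22 (negPf f2n0).
  + by exists f1.
  + by exists f2.
  + case=> x [xn0]; have [p [q ex]] := frf.1 x => /(_ f2).
    rewrite ex bilin_lcl // e12 e22 -/(lc _ _ _ _) -ex => x0.
    by rewrite x0 eqxx in xn0.
- apply: (commutative_of_frame frf) => //; first by rewrite e12.
  have tf : table_in mul f1 f2 0 0 0 0 0 0 1 0 by split; rewrite ?(lc10, lc01, lc00).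
  have mulE := bilin_table bilm tf.
  split; split=> //.
  + by move/(_ f2 f2)/eqP; rewrite e22 (negPf f1n0).
  + by exists f1.
  + case=> x [xn0]; have [p [q ex]] := frf.1 x; rewrite ex mulE => /(frame_inj frf) [].
    rewrite !(mulr0, addr0, add0r, mulr1) => ep eq.
    by rewrite ex -ep -eq mulr0 lc00 eqxx in xn0.
  + move=> _; exists f1; split=> // y; have [r [s ->]] := frf.1 y.
    by rewrite (linear_lc _ _ _ _ (bilm.2 f1)) e11 e12 !scaler0 addr0.
- apply: (@affine_of_opposite_frame _ f1 f2 1 0 (- 1)); try lc_table e11 e12 e21 e22.
  by invariant_simp.
- apply: (@affine_of_opposite_frame _ f1 f2 0 1 0); try lc_table e11 e12 e21 e22.
  by invariant_simp.
- apply: (@affine_of_opposite_frame _ f1 f2 0 0 (- 1)); try lc_table e11 e12 e21 e22.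
  by invariant_simp.
- apply: (@nonabelian_of_frame _ f1 f2 0 0 0 a); try lc_table e11 e12 e21 e22.
  by invariant_simp.
- apply: (@nonabelian_of_frame _ f1 f2 0 a 0 a); try lc_table e11 e12 e21 e22.
  by invariant_simp.
- apply: (@nonabelian_of_frame _ f1 f2 0 0 1 (- 1)); try lc_table e11 e12 e21 e22.
  by invariant_simp.
- apply: (@nonabelian_of_frame _ f1 f2 1 0 0 (- 2)); try lc_table e11 e12 e21 e22.
  by invariant_simp.
- apply: (@nonabelian_of_frame _ f1 f2 0 1 1 1); try lc_table e11 e12 e21 e22.
  have e : 2 * 1 - 1 - 1 = 0 :> k by ring.
  by rewrite /nonabelian_invariant e; invariant_simp.
- apply: (@affine_of_frame _ f1 f2 0 0 (1 - a) 0); try lc_table e11 e12 e21 e22.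
  by invariant_simp.
- apply: (@affine_of_frame _ f1 f2 0 0 0 1); try lc_table e11 e12 e21 e22.
  by invariant_simp.
- apply: (@affine_of_frame _ f1 f2 0 (- 1) (- a) 0); try lc_table e11 e12 e21 e22.
  by invariant_simp.
- apply: (@affine_of_frame _ f1 f2 0 (- 1) 1 1); try lc_table e11 e12 e21 e22.
  by invariant_simp.
Qed.

End RealizedInvariant.

(** * The classification *)

Theorem mainTheorem3 (R : realType) :
  (forall m : pl_index R[i],
      post_lie (pl_mul m) (pl_br m) /\
      assoc_lie (pl_mul m) (pl_br m) (e1 R[i]) (e2 R[i]) = t_lie (table m)) /\
  (forall (V : vectType R[i]) (mul br : V -> V -> V),
      \dim {:V} = 2%N -> post_lie mul br ->
      exists! m : pl_index R[i],
        post_lie_iso mul br (pl_mul m) (pl_br m)).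
Proof.
split=> [m|V mul br dimV plV].
  by split; [apply: pl_post_lie | apply: pl_assoc_lie].
have two_neq0 : 2 != 0 :> R[i] by rewrite Num.Theory.pnatr_eq0.
have [f1 [f2 frf]] := frame_exists dimV.
have [m [g1 [g2 [frg rg]]]] := post_lie_normal_form two_neq0 plV frf.
exists m; split=> [|m' iso_m'].
  exact: iso_of_frame (pl_mul_bilin plV) (pl_br_bilin plV)
    (br_alternating two_neq0 plV) frg rg.
have [h1 [h2 [frh rh]]] := frame_of_iso iso_m'.
apply: invariant_inj; apply: (invariant_unique two_neq0 plV).
  exact: realizes_invariant frg rg.
exact: realizes_invariant frh rh.
Qed.
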